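(* For positive co-prime integers $m$ and $n$, the number $D_T^{(m,n)}$ of toroidal knot $(m,n)$-mosaics is $$D_T^{(m,n)} = \sum_{p \mid m,\; q \mid n} \frac{1}{pq}\, d_{p,q},$$ where the sum is over positive divisors $p$ of $m$ and $q$ of $n$, and the positive integers $d_{p,q}$ are recursively defined by $$d_{p,q} = D_{P}^{(p,q)} - \sum_{r \mid p,\; s \mid q,\; rs \neq pq} d_{r,s},$$ with $D_P^{(p,q)}$ the number of period knot $(p,q)$-mosaics.
   Context: Mosaic tiles: there are eleven tiles $T_0,\dots,T_{10}$ (unit squares with curves drawn on them). A connection point of a tile is the midpoint of an edge (left, right, top, bottom) of the tile that is an endpoint of a curve drawn on the tile. The sets of edges carrying connection points are as follows: $T_0$: none; $T_1$: left, bottom; $T_2$: right, bottom; $T_3$: right, top; $T_4$: left, top; $T_5$: left, right; $T_6$: top, bottom; $T_7,T_8,T_9,T_{10}$: all four edges. Thus each two-element set of edges occurs for exactly one tile, the empty set for exactly one tile, and the full set for exactly four (distinct) tiles. For positive integers $m,n$, an $(m,n)$-mosaic is an $m\times n$ matrix $M=(M_{ij})$ of mosaic tiles (row 1 at the top, column 1 at the left). It is suitably connected if any two tiles immediately next to each other in the same row or the same column either both have or both do not have a connection point on their common edge. It is suitably $\partial$-connected if for each row, the leftmost tile has a connection point on its left edge if and only if the rightmost tile has one on its right edge, and for each column, the topmost tile has a connection point on its top edge if and only if the bottommost tile has one on its bottom edge (when $n=1$ or $m=1$ the two tiles in question coincide). A period knot $(m,n)$-mosaic is a suitably connected and suitably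 $\partial$-connected $(m,n)$-mosaic; $D_P^{(m,n)}$ denotes the number of these. Two period knot $(m,n)$-mosaics are equivalent if one can be obtained from the other by a finite sequence of cyclic rotations of rows and columns, i.e. if for some integers $x,y$ one is $(M_{ij})$ and the other is $(M_{i-x,j-y})$, with row indices taken modulo $m$ and column indices modulo $n$. (Tiles themselves are not rotated.) A toroidal knot $(m,n)$-mosaic is an equivalence class of period knot $(m,n)$-mosaics; $D_T^{(m,n)}$ denotes the number of these classes. *)

(* Defs.v *)
From mathcomp Require Import all_boot all_order all_algebra zify.

Set Implicit Arguments.
Unset Strict Implicit.
Unset Printing Implicit Defensive.

Import GRing.Theory.

(* k : tile stands for the mosaic tile T_k. *)
Notation tile := 'I_11.

Inductive edge := Left | Right | Top | Bottom.

(* Midpoints of edges at which a curve drawn on the tile ends;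
   T_7, T_8, T_9, T_10 have all four. *)
Definition connection_point (t : tile) (e : edge) : bool :=
  match nat_of_ord t, e with
  | 0, _ => false
  | 1, (Left | Bottom) => true
  | 2, (Right | Bottom) => true
  | 3, (Right | Top) => true
  | 4, (Left | Top) => true
  | 5, (Left | Right) => true
  | 6, (Top | Bottom) => true
  | (1 | 2 | 3 | 4 | 5 | 6), _ => false
  | _, _ => true
  end.

Section Mosaics.

Variables m n : nat.

(* Row 0 is the top row and column 0 the leftmost column. *)
Notation mosaic := 'M[tile]_(m, n).
Implicit Types M N : mosaic.

Definition suitably_connected M : bool :=
  [forall i : 'I_m, forall j : 'I_n, forall j' : 'I_n, (j' == j.+1 :> nat) ==>
     (connection_point (M i j) Right == connection_point (M i j') Left)] &&
  [forall j : 'I_n, forall i : 'I_m, forall i' : 'I_m, (i' == i.+1 :> nat) ==>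
     (connection_point (M i j) Bottom == connection_point (M i' j) Top)].

Definition suitably_bd_connected M : bool :=
  [forall i : 'I_m, forall j : 'I_n, forall j' : 'I_n, (j == 0 :> nat) && (j'.+1 == n) ==>
     (connection_point (M i j) Left == connection_point (M i j') Right)] &&
  [forall j : 'I_n, forall i : 'I_m, forall i' : 'I_m, (i == 0 :> nat) && (i'.+1 == m) ==>
     (connection_point (M i j) Top == connection_point (M i' j) Bottom)].

Definition period_mosaics : {set mosaic} :=
  [set M | suitably_connected M && suitably_bd_connected M].

Definition D_P : nat := #|period_mosaics|.

(* Rotations by one step: ord_pred is i |-> i - 1 modulo the size. *)
Definition rotate_rows M : mosaic := \matrix_(i, j) M (ord_pred i) j.
Definition rotate_cols M : mosaic := \matrix_(i, j) M i (ord_pred j).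

(* N is obtained from M by a finite sequence of rotations; mosaic_equivP gives
   the description by integer shifts of both indices. *)
Definition mosaic_equiv : rel mosaic :=
  connect [rel M N | (N == rotate_rows M) || (N == rotate_cols M)].

Definition toroidal_mosaics : {set {set mosaic}} :=
  equivalence_partition mosaic_equiv period_mosaics.

Definition D_T : nat := #|toroidal_mosaics|.

End Mosaics.

Local Open Scope ring_scope.

(* The argument k is fuel; it suffices in d when p, q > 0: see dE. *)
Fixpoint d_fuel (k p q : nat) : int :=
  if k is k'.+1 then
    (D_P p q)%:Z -
      \sum_(r <- divisors p) \sum_(s <- divisors q | (r * s != p * q)%N)
        d_fuel k' r s
  else 0.

Definition d (p q : nat) : int := d_fuel (p * q).+1 p q.

Lemma d_fuelS k p q :
  d_fuel k.+1 p q = (D_P p q)%:Z -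
    \sum_(r <- divisors p) \sum_(s <- divisors q | (r * s != p * q)%N)
      d_fuel k r s.
Proof. by []. Qed.

Lemma d_fuelE k p q : (0 < p)%N -> (0 < q)%N -> (p * q < k)%N ->
  d_fuel k p q = d p q.
Proof.
rewrite /d; have [l] := ubnP (p * q).+1.
elim: l k p q => // l IHl [//|k] p q lepq p0 q0 ltk; rewrite !d_fuelS; congr (_ - _).
rewrite big_seq [RHS]big_seq; apply: eq_bigr => r; rewrite -dvdn_divisors // => rp.
rewrite big_seq_cond [RHS]big_seq_cond.
apply: eq_bigr => s /andP[]; rewrite -dvdn_divisors // => sq neq.
have lt_rs : (r * s < p * q)%N.
  by rewrite ltn_neqAle neq leq_mul // dvdn_leq.
have [r0 s0] := (dvdn_gt0 p0 rp, dvdn_gt0 q0 sq).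
by rewrite (IHl k) // 1?(IHl (p * q)%N) //; lia.
Qed.

Lemma dE p q : (0 < p)%N -> (0 < q)%N ->
  d p q = (D_P p q)%:Z -
    \sum_(r <- divisors p) \sum_(s <- divisors q | (r * s != p * q)%N) d r s.
Proof.
move=> p0 q0; rewrite -[LHS](@d_fuelE (p * q).+2) // d_fuelS; congr (_ - _).
rewrite big_seq [RHS]big_seq; apply: eq_bigr => r; rewrite -dvdn_divisors // => rp.
rewrite big_seq_cond [RHS]big_seq_cond.
apply: eq_bigr => s /andP[]; rewrite -dvdn_divisors // => sq _.
apply: d_fuelE; first exact: dvdn_gt0 rp.
  exact: dvdn_gt0 sq.
by rewrite ltnS leq_mul // dvdn_leq.
Qed.

Lemma iter_ord_predE n a (i : 'I_n) :
  (iter a (@ord_pred n) i)%:Z = ((i%:Z - a%:Z) %% n)%Z.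
Proof.
have n0 : (0 < n)%N by case: i => i; case: n.
elim: a => [|a IHa] /=; first by rewrite subr0 modz_nat modn_small.
set u := iter _ _ _ in IHa *.
have -> : (i%:Z - a.+1%:Z = (i%:Z - a%:Z) - 1)%R by lia.
rewrite -modzDml -IHa -modz_nat.
have -> : ((u + n).-1%:Z = (u%:Z - 1) + n%:Z)%R by lia.
by rewrite modzDr.
Qed.

Lemma iter_rotate m n a b (M : 'M[tile]_(m, n)) i j :
  iter a (@rotate_rows m n) (iter b (@rotate_cols m n) M) i j =
  M (iter a (@ord_pred m) i) (iter b (@ord_pred n) j).
Proof.
elim: a i => [|a IHa] i /=; last by rewrite mxE IHa -iterSr.
by elim: b j => [//|b IHb] j; rewrite mxE IHb -iterSr.
Qed.

Lemma mosaic_equivP m n (M N : 'M[tile]_(m, n)) :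
  reflect (exists x y : int, forall (i : 'I_m) (j : 'I_n) (i' : 'I_m) (j' : 'I_n),
             (i'%:Z = i%:Z - x %[mod m])%Z -> (j'%:Z = j%:Z - y %[mod n])%Z ->
             N i j = M i' j')
          (mosaic_equiv M N).
Proof.
have stepP a (K : 'M[tile]_(m, n)) b :
    connect [rel M N | (N == rotate_rows M) || (N == rotate_cols M)] K
      (iter a (@rotate_rows m n) (iter b (@rotate_cols m n) K)).
  elim: a => [|a IHa] /=.
    elim: b => [|b IHb] //=; apply: connect_trans IHb (connect1 _).
    by rewrite /= eqxx orbT.
  by apply: connect_trans IHa (connect1 _); rewrite /= eqxx.
apply: (iffP idP) => [/connectP[s]|[x [y eqN]]].
  elim/last_ind: s N => [|s K IHs] N.
    move=> _ -> ; exists 0, 0 => i j i' j'; rewrite !subr0 => ii' jj'.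
    by congr (M _ _); apply: ord_inj; rewrite !modz_nat !modn_small // in ii' jj';
      case: ii'; case: jj'.
  rewrite rcons_path last_rcons => /andP[Ms /= stp] ->.
  have [x [y eqL]] := IHs _ Ms erefl.
  have predE k (i : 'I_k) : ((ord_pred i)%:Z = i%:Z - 1 %[mod k])%Z.
    by rewrite (iter_ord_predE 1 i) modz_mod.
  case/orP: stp => /eqP ->.
    exists (x + 1), y => i j i' j' ii' jj'; rewrite mxE; apply: eqL => //.
    rewrite ii' -[RHS]modzDml predE modzDml; congr (_ %% _)%Z; lia.
  exists x, (y + 1) => i j i' j' ii' jj'; rewrite mxE; apply: eqL => //.
  rewrite jj' -[RHS]modzDml predE modzDml; congr (_ %% _)%Z; lia.
suff -> : N = iter `|(x %% m)%Z|%N (@rotate_rows m n)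
               (iter `|(y %% n)%Z|%N (@rotate_cols m n) M) by apply: stepP.
apply/matrixP => i j; rewrite iter_rotate; apply: eqN.
  rewrite iter_ord_predE modz_mod gez0_abs ?modz_ge0 //; last by case: i; lia.
  by rewrite -modzDmr -modzNm -[RHS]modzDmr -[in RHS]modzNm modz_mod.
rewrite iter_ord_predE modz_mod gez0_abs ?modz_ge0 //; last by case: j; lia.
by rewrite -modzDmr -modzNm -[RHS]modzDmr -[in RHS]modzNm modz_mod.
Qed.

(* Main.v *)
Require Import Defs.
From mathcomp Require Import all_boot all_order all_algebra.

Import GRing.Theory Num.Theory.

(** Since m and n are coprime, the group Z/m x Z/n of rotations is cyclic,
    generated by the diagonal rotation that moves every row and every column
    by one step.  Toroidal mosaics are therefore the orbits of this single
    permutation on the period mosaics ([mosaic_equivE]), and every orbit size,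
    being a divisor of m n, is p q for a unique pair p | m, q | n
    ([mul_gcd_coprime], [eqn_mul_coprime]).

    A mosaic whose orbit has size p q has vertical period p and horizontal
    period q: a shift by p rows is a power of the diagonal rotation whose
    exponent is divisible by p q.  So it is the periodic extension of a (p, q)
    block, and this block is itself a period mosaic with an orbit of full size
    p q.  Calling such blocks primitive, periodic extension is a bijection
    between primitive (p, q)-mosaics and period (m, n)-mosaics with an orbit of
    size p q ([card_period_order]).  Hence a sum over the period mosaics of a
    function of the orbit size is a sum over pairs of divisors weighted by
    numbers of primitive mosaics ([sum_period_by_order]).

    This identity is used twice.  For the constant function 1 it reads
    D_P(p, q) = sum over r | p, s | q of the number of primitive
    (r, s)-mosaics, which is the recursion defining d, so d counts primitive
    mosaics ([d_primitive]).  For the inverse of the orbit size, the left side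
    counts the orbits ([D_T_inv_order]), which gives the formula.  Positivity of
    d holds because changing one tile in an array of T_7 to T_8 produces a
    primitive mosaic ([primitive_neq0]). *)

Set Implicit Arguments.
Unset Strict Implicit.
Unset Printing Implicit Defensive.

(** * Orbits of an injective map and products of coprime divisors *)

Lemma iter_eq_order (T : finType) (f : T -> T) (f_inj : injective f) k x :
  (iter k f x == x) = (order f x %| k).
Proof.
have iterMo c : iter (c * order f x) f x = x.
  by rewrite iterM iter_fix // iter_order.
rewrite /dvdn {1}(divn_eq k (order f x)) addnC iterD iterMo.
have lt_r : k %% order f x < order f x by rewrite ltn_mod order_gt0.
apply/eqP/eqP => [/(congr1 (findex f x))|-> //].
by rewrite findex_iter // findex0.
Qed.

Lemma order_morph (T U : finType) (f : T -> T) (g : U -> U) (h : T -> U) x :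
    injective f -> injective g -> injective h -> {morph h : y / f y >-> g y} ->
  order g (h x) = order f x.
Proof.
move=> f_inj g_inj h_inj hM.
have hiter k : iter k g (h x) = h (iter k f x).
  by elim: k => //= k ->; rewrite hM.
apply/eqP; rewrite eqn_dvd -!iter_eq_order //.
by rewrite hiter iter_order // eqxx -(inj_eq h_inj) -hiter iter_order // eqxx.
Qed.

(** The pair of divisors behind a divisor of m n; by [eqn_mul_coprime] it is
    the only one. *)
Lemma mul_gcd_coprime m n k : coprime m n -> k %| m * n ->
  gcdn k m * gcdn k n = k.
Proof.
move=> co_mn k_mn; apply/eqP; rewrite eqn_dvd; apply/andP; split.
  rewrite Gauss_dvd ?dvdn_gcdl //.
  exact: coprime_dvdl (dvdn_gcdr k m) (coprime_dvdr (dvdn_gcdr k n) co_mn).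
by rewrite muln_gcdr dvdn_gcd dvdn_mull //= muln_gcdl dvdn_gcd dvdn_mulr.
Qed.

Lemma eqn_mul_coprime m n p q r s : coprime m n ->
    p %| m -> q %| n -> r %| m -> s %| n ->
  (r * s == p * q) = (r == p) && (s == q).
Proof.
move=> co_mn pm qn rm sn; apply/eqP/andP => [e|[/eqP-> /eqP->] //].
(* The factors of a * b are recovered as its gcds with m and n. *)
have gl a b : a %| m -> b %| n -> gcdn m (a * b) = a.
  by move=> am bn; rewrite Gauss_gcdl ?(coprime_dvdr bn co_mn) //; apply/gcdn_idPr.
have gr a b : a %| m -> b %| n -> gcdn n (a * b) = b.
  move=> am bn; rewrite Gauss_gcdr; first exact/gcdn_idPr.
  by rewrite coprime_sym (coprime_dvdl am co_mn).
by rewrite -[X in X == p](gl r s) // -[X in X == q](gr r s) // e gl // gr.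
Qed.

(** Selecting a pair of divisors by its product is selecting it outright; this
    turns both the grouping of mosaics by orbit size and the condition
    r s <> p q of the recursion into statements about a single term. *)
Lemma sum_divisors_pick (V : nmodType) (F : nat -> nat -> V) m n p q :
    0 < m -> 0 < n -> coprime m n -> p %| m -> q %| n ->
  (\sum_(r <- divisors m) \sum_(s <- divisors n | (r * s == p * q)%N) F r s
     = F p q)%R.
Proof.
move=> m0 n0 co_mn pm qn.
transitivity (\sum_(r <- divisors m) \sum_(s <- divisors n)
    if (r == p) && (s == q) then F r s else 0)%R.
  apply: eq_big_seq => r; rewrite -dvdn_divisors // => rm.
  rewrite big_mkcond /=; apply: eq_big_seq => s; rewrite -dvdn_divisors // => sn.
  by rewrite (eqn_mul_coprime co_mn).
rewrite (bigD1_seq p) ?divisors_uniq -?dvdn_divisors //=.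
rewrite [X in (_ + X)%R]big1 ?addr0 => [|r /negPf->]; last by rewrite big1.
rewrite (bigD1_seq q) ?divisors_uniq -?dvdn_divisors //= !eqxx /=.
by rewrite big1 ?addr0 // => s /negPf->.
Qed.

(** * Iterated cyclic shifts of indices *)

Section OrdPred.

Variable n : nat.
Implicit Type i : 'I_n.

Lemma iter_ord_pred_sub a i : a <= i -> iter a (@ord_pred n) i = i - a :> nat.
Proof.
move=> le_ai; apply/eqP; rewrite -eqz_nat iter_ord_predE subzn // modz_nat modn_small //.
exact: leq_ltn_trans (leq_subr _ _) (ltn_ord i).
Qed.

Lemma iter_ord_pred_mod a b i :
  a = b %[mod n] -> iter a (@ord_pred n) i = iter b (@ord_pred n) i.
Proof.
move=> eq_ab; apply/ord_inj/eqP; rewrite -eqz_nat !iter_ord_predE.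
by rewrite -modzDmr -modzNm modz_nat eq_ab -modz_nat modzNm modzDmr.
Qed.

Lemma iter_ord_pred_eq a i : n %| a -> iter a (@ord_pred n) i = i.
Proof. by move=> /eqP an; rewrite (@iter_ord_pred_mod a 0) // an mod0n. Qed.

End OrdPred.

(** * The diagonal rotation *)

Section Rotation.

Variables m n : nat.
Implicit Types M N : 'M[tile]_(m, n).

Definition rotate M := rotate_rows (rotate_cols M).

Lemma iter_rotateE k M i j :
  iter k rotate M i j = M (iter k (@ord_pred m) i) (iter k (@ord_pred n) j).
Proof. by elim: k i j => //= k IH i j; rewrite !mxE IH -!iterSr. Qed.

Lemma rotate_inj : injective rotate.
Proof.
move=> M N /matrixP e; apply/matrixP => i j.
by have := e (ordS i) (ordS j); rewrite !mxE !ordSK.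
Qed.

Lemma order_rotate_dvd M : order rotate M %| m * n.
Proof.
rewrite -iter_eq_order; last exact: rotate_inj.
apply/eqP/matrixP => i j; rewrite iter_rotateE.
by rewrite iter_ord_pred_eq ?dvdn_mulr // iter_ord_pred_eq ?dvdn_mull.
Qed.

(** By the Chinese remainder theorem, a shift by a rows and b columns is the
    k-th power of the diagonal rotation for any k congruent to a mod m and to
    b mod n. *)
Lemma mosaic_equivE : coprime m n -> @mosaic_equiv m n =2 fconnect rotate.
Proof.
move=> co_mn M N; apply/idP/idP; apply: connect_sub => {}M {}N /=; last first.
  move/eqP <-; apply: (@connect_trans _ _ (rotate_cols M));
  by apply: connect1; rewrite /= eqxx ?orbT.
have rot a b : fconnect rotate M
    (iter a (@rotate_rows m n) (iter b (@rotate_cols m n) M)).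
  suff -> : iter a (@rotate_rows m n) (iter b (@rotate_cols m n) M) =
    iter (chinese m n a b) rotate M by apply: fconnect_iter.
  apply/matrixP => i j; rewrite iter_rotate iter_rotateE.
  by congr (M _ _); apply: iter_ord_pred_mod; rewrite ?chinese_modl ?chinese_modr.
by case/orP => /eqP ->; [apply: (rot 1 0) | apply: (rot 0 1)].
Qed.

(** On the torus the two connectivity conditions become one: the neighbour of
    the first row or column is the last one.  This form involves only
    [ord_pred], so it passes through every map commuting with [ord_pred]. *)
Lemma period_mosaicP M :
  reflect (forall i j,
      connection_point (M i j) Left = connection_point (M i (ord_pred j)) Right /\
      connection_point (M i j) Top = connection_point (M (ord_pred i) j) Bottom)
    (M \in period_mosaics m n).
Proof.
have predn0 k (i : 'I_k) : 0 < i -> (ord_pred i : nat) = i.-1.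
  by move=> i0; have := iter_ord_pred_sub i0; rewrite subn1.
have pred0 k (i : 'I_k) : (i : nat) = 0 -> (ord_pred i).+1 = k.
  move=> /= ->; case: k i => [[]//|k] _; by rewrite add0n modn_small.
rewrite inE; apply: (iffP idP).
  case/andP=> /andP[/forallP cR /forallP cC] /andP[/forallP bR /forallP bC] i j.
  split.
    have [j0|j0] := posnP j.
      move/forallP/(_ j)/forallP/(_ (ord_pred j))/implyP: (bR i).
      by rewrite j0 eqxx pred0 ?eqxx // => /(_ isT)/eqP.
    move/forallP/(_ (ord_pred j))/forallP/(_ j)/implyP: (cR i).
    by rewrite predn0 // prednK // eqxx => /(_ isT)/eqP.
  have [i0|i0] := posnP i.
    move/forallP/(_ i)/forallP/(_ (ord_pred i))/implyP: (bC j).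
    by rewrite i0 eqxx pred0 ?eqxx // => /(_ isT)/eqP.
  move/forallP/(_ (ord_pred i))/forallP/(_ i)/implyP: (cC j).
  by rewrite predn0 // prednK // eqxx => /(_ isT)/eqP.
have predS k (i i' : 'I_k) : i' = i.+1 :> nat -> i = ord_pred i'.
  by move=> e; apply: ord_inj; rewrite predn0 e.
have pred_max k (i i' : 'I_k) : i = 0 :> nat -> i'.+1 = k -> i' = ord_pred i.
  by move=> i0 e; apply: ord_inj; apply: succn_inj; rewrite pred0.
move=> cM; rewrite /suitably_connected /suitably_bd_connected.
apply/andP; split; apply/andP; split; apply/forallP => x;
  apply/forallP => y; apply/forallP => z; apply/implyP.
- by move=> /eqP/predS ->; rewrite (cM x z).1.
- by move=> /eqP/predS ->; rewrite (cM z x).2.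
- by case/andP=> /eqP y0 /eqP/(pred_max _ _ _ y0) ->; rewrite (cM x y).1.
- by case/andP=> /eqP y0 /eqP/(pred_max _ _ _ y0) ->; rewrite (cM y x).2.
Qed.

Lemma period_rotate M :
  M \in period_mosaics m n -> rotate M \in period_mosaics m n.
Proof. by move/period_mosaicP=> cM; apply/period_mosaicP => i j; rewrite !mxE; apply: cM. Qed.

(** The full orbit size m n amounts to the absence of symmetry under any
    nontrivial rotation, provided m and n are coprime. *)
Definition primitive : {set 'M[tile]_(m, n)} :=
  [set M in period_mosaics m n | order rotate M == m * n].

(** An array of T_7 with a single T_8 in a corner: both tiles meet all four
    edges, so every connectivity condition holds, and a rotation fixing the
    array must bring the corner back to itself. *)
Lemma primitive_neq0 : 0 < m -> 0 < n -> coprime m n -> 0 < #|primitive|.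
Proof.
move=> m0 n0 co_mn; apply/card_gt0P.
pose i0 := Ordinal m0; pose j0 := Ordinal n0.
pose t7 : tile := inord 7; pose t8 : tile := inord 8.
pose M : 'M[tile]_(m, n) :=
  (\matrix_(i, j) if (i == i0) && (j == j0) then t8 else t7)%R.
exists M; rewrite inE; apply/andP; split.
  have full e i j : connection_point (M i j) e.
    by rewrite mxE /connection_point; case: ifP => _; rewrite inordK.
  by apply/period_mosaicP => i j; rewrite !full.
rewrite eqn_dvd order_rotate_dvd Gauss_dvd //.
have : iter (order rotate M) rotate M = M by apply: iter_order rotate_inj _.
set k := order _ _; move/matrixP/(_ i0 j0); rewrite iter_rotateE !mxE !eqxx /=.
have dvd l (l0 : 0 < l) : iter k (@ord_pred l) (Ordinal l0) = Ordinal l0 -> l %| k.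
  (* Index 0 is sent to - k mod l. *)
  move=> e; have := iter_ord_predE k (Ordinal l0); rewrite e /= sub0r.
  by move=> /esym/dvdz_mod0P; rewrite dvdzE abszN.
case: ifP => [/andP[/eqP/dvd -> /eqP/dvd -> //]|_ /(congr1 val)].
by rewrite /= !inordK.
Qed.

End Rotation.

(** * Periodic extension of a block *)

Section Tiling.

Variables (m n p q : nat).
Hypotheses (p_gt0 : 0 < p) (q_gt0 : 0 < q) (pm : p %| m) (qn : q %| n).

Definition ord_mod k (k_gt0 : 0 < k) l (i : 'I_l) : 'I_k :=
  Ordinal (ltn_pmod i k_gt0).

Lemma ord_mod_pred k (k_gt0 : 0 < k) l (i : 'I_l) : k %| l ->
  ord_mod k_gt0 (ord_pred i) = ord_pred (ord_mod k_gt0 i).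
Proof.
move=> kl; apply: ordS_inj; rewrite ord_predK -{2}[i]ord_predK.
by apply: ord_inj; rewrite /= -addn1 modnDml addn1 modn_dvdm.
Qed.

Definition tiling (M : 'M[tile]_(p, q)) : 'M[tile]_(m, n) :=
  (\matrix_(i, j) M (ord_mod p_gt0 i) (ord_mod q_gt0 j))%R.

Hypotheses (m_gt0 : 0 < m) (n_gt0 : 0 < n).

Lemma tiling_widen M i j :
  tiling M (widen_ord (dvdn_leq m_gt0 pm) i) (widen_ord (dvdn_leq n_gt0 qn) j) =
  M i j.
Proof. by rewrite mxE; congr (M _ _); apply: ord_inj; rewrite /= modn_small. Qed.

Lemma tiling_inj : injective tiling.
Proof.
by move=> M N eMN; apply/matrixP => i j; rewrite -tiling_widen eMN tiling_widen.
Qed.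

Lemma rotate_tiling : {morph tiling : M / rotate M >-> rotate M}.
Proof. by move=> M; apply/matrixP => i j; rewrite !mxE !ord_mod_pred. Qed.

Lemma order_rotate_tiling M : order (@rotate m n) (tiling M) = order (@rotate p q) M.
Proof.
apply: order_morph rotate_tiling; [exact: rotate_inj|exact: rotate_inj|].
exact: tiling_inj.
Qed.

Lemma period_tiling M :
  (tiling M \in period_mosaics m n) = (M \in period_mosaics p q).
Proof.
apply/period_mosaicP/period_mosaicP => cM i j; last first.
  by rewrite !mxE !ord_mod_pred.
pose i' := widen_ord (dvdn_leq m_gt0 pm) i.
pose j' := widen_ord (dvdn_leq n_gt0 qn) j.
have := cM i' j'; rewrite !mxE !ord_mod_pred //.
by have [-> ->] : ord_mod p_gt0 i' = i /\ ord_mod q_gt0 j' = j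
  by split; apply: ord_inj; rewrite /= modn_small.
Qed.

(** Position (i, j) is moved to (i mod p, j mod q) by a rotation through
    multiples of p and q.  As a power of the diagonal rotation it has an exponent
    divisible by p q, hence it fixes N. *)
Lemma tiling_of_order N : coprime m n -> order (@rotate m n) N = p * q ->
  exists M, N = tiling M.
Proof.
move=> co_mn oN.
exists (\matrix_(i, j) N (widen_ord (dvdn_leq m_gt0 pm) i)
                         (widen_ord (dvdn_leq n_gt0 qn) j))%R.
apply/matrixP => i j; rewrite !mxE.
pose k := chinese m n (i %/ p * p) (j %/ q * q).
have k_m : k = i %/ p * p %[mod m] by apply: chinese_modl.
have k_n : k = j %/ q * q %[mod n] by apply: chinese_modr.
have pq_k : p * q %| k.
  rewrite Gauss_dvd ?(coprime_dvdl pm (coprime_dvdr qn co_mn)) //.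
  rewrite /dvdn -(modn_dvdm k pm) k_m modn_dvdm // modnMl eqxx /=.
  by rewrite -(modn_dvdm k qn) k_n modn_dvdm // modnMl.
have fixN : iter k (@rotate m n) N = N.
  by apply/eqP; rewrite iter_eq_order ?oN //; apply: rotate_inj.
rewrite -{1}fixN iter_rotateE (iter_ord_pred_mod _ k_m) (iter_ord_pred_mod _ k_n).
congr (N _ _); apply: ord_inj; rewrite iter_ord_pred_sub ?leq_trunc_div //=.
  by rewrite {1}(divn_eq i p) addKn.
by rewrite {1}(divn_eq j q) addKn.
Qed.

Lemma card_period_order : coprime m n ->
  #|[set M in period_mosaics m n | order (@rotate m n) M == p * q]| =
  #|primitive p q|.
Proof.
move=> co_mn; rewrite -(card_imset _ tiling_inj); apply: eq_card => N.
apply/setIdP/imsetP => [[perN /eqP oN]|[M /setIdP[perM oM] ->]].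
  have [M eN] := tiling_of_order co_mn oN; exists M => //.
  by rewrite inE -period_tiling -order_rotate_tiling -eN perN oN /=.
by rewrite period_tiling order_rotate_tiling.
Qed.

End Tiling.

(** * Counting by orbit size *)

Lemma sum_period_by_order (V : nmodType) (F : nat -> V) m n :
    0 < m -> 0 < n -> coprime m n ->
  (\sum_(M in period_mosaics m n) F (order (@rotate m n) M) =
   \sum_(p <- divisors m) \sum_(q <- divisors n)
     F (p * q)%N *+ #|primitive p q|)%R.
Proof.
move=> m_gt0 n_gt0 co_mn.
transitivity (\sum_(M in period_mosaics m n)
  \sum_(p <- divisors m) \sum_(q <- divisors n | (p * q == order (@rotate m n) M)%N)
     F (p * q)%N)%R.
  apply: eq_bigr => M _.
  have dvdM := order_rotate_dvd M; rewrite -(mul_gcd_coprime co_mn dvdM).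
  by rewrite sum_divisors_pick ?dvdn_gcdr.
rewrite exchange_big; apply: eq_big_seq => p; rewrite -dvdn_divisors //= => pm.
under eq_bigr do rewrite big_mkcond.
rewrite exchange_big; apply: eq_big_seq => q; rewrite -dvdn_divisors //= => qn.
have [p_gt0 q_gt0] := (dvdn_gt0 m_gt0 pm, dvdn_gt0 n_gt0 qn).
rewrite -(card_period_order p_gt0 q_gt0 pm qn m_gt0 n_gt0 co_mn) -sumr_const.
rewrite -big_mkcondr; apply: eq_bigl => M; rewrite inE.
by rewrite [(p * q == _)%N]eq_sym.
Qed.

(** Primitive counts satisfy the recursion of [dE]: grouping all period
    (p, q)-mosaics by orbit size, the only term with r s = p q is the number of
    primitive (p, q)-mosaics. *)
Lemma d_primitive p q : 0 < p -> 0 < q -> coprime p q ->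
  d p q = (#|primitive p q|%:R)%R.
Proof.
have [k] := ubnP (p * q); elim: k p q => // k IHk p q lt_k p_gt0 q_gt0 co_pq.
have D_PE : ((D_P p q)%:Z =
    \sum_(r <- divisors p) \sum_(s <- divisors q) #|primitive r s|%:R)%R.
  have := sum_period_by_order (fun=> 1%R : int) p_gt0 q_gt0 co_pq.
  by rewrite /= sumr_const -/(D_P p q) natz.
rewrite dE // D_PE; apply/eqP; rewrite subr_eq -[X in (X + _)%R](@sum_divisors_pick _
  (fun r s => #|primitive r s|%:R)%R _ _ _ _ p_gt0 q_gt0 co_pq) // -big_split /=.
apply/eqP; apply: eq_big_seq => r; rewrite -dvdn_divisors // => rp.
rewrite (bigID (fun s => r * s == p * q)) /=; congr (_ + _)%R.
rewrite big_seq_cond [RHS]big_seq_cond; apply: eq_bigr => s /andP[].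
rewrite -dvdn_divisors // => sq neq.
have [r_gt0 s_gt0] := (dvdn_gt0 p_gt0 rp, dvdn_gt0 q_gt0 sq).
rewrite IHk //; last exact: coprime_dvdl rp (coprime_dvdr sq co_pq).
rewrite -ltnS (leq_trans _ lt_k) // !ltnS ltn_neqAle neq.
by rewrite leq_mul // dvdn_leq.
Qed.

(** Each orbit contributes its size times the inverse of its size. *)
Lemma D_T_inv_order m n : coprime m n ->
  ((D_T m n)%:R =
   \sum_(M in period_mosaics m n) (order (@rotate m n) M)%:R^-1 :> rat)%R.
Proof.
move=> co_mn.
have symR := fconnect_sym (@rotate_inj m n).
have eqvR : equivalence_rel (@mosaic_equiv m n).
  apply/equivalence_relP; split=> [M|M N e P]; first by rewrite mosaic_equivE.
  move: e; rewrite !mosaic_equivE // => e.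
  exact: (same_connect symR e).
have part : partition (toroidal_mosaics m n) (period_mosaics m n).
  by apply: equivalence_partitionP => M N P _ _ _; apply: eqvR.
rewrite (set_partition_big _ part) /D_T -sum1_card natr_sum /=.
apply: eq_bigr => B /imsetP[M perM eB].
have orbB : B =i fconnect (@rotate m n) M.
  move=> N; rewrite eB in_set mosaic_equivE // andb_idl // => /iter_findex <-.
  by elim: (findex _ _ _) => //= k; apply: period_rotate.
have cardB : #|B| = order (@rotate m n) M by apply: eq_card orbB.
have ordB N : N \in B -> order (@rotate m n) N = #|B|.
  by rewrite orbB cardB => MN; rewrite /order -(eq_card (same_connect symR MN)).
under eq_bigr => N BN do rewrite ordB //.
by rewrite sumr_const -[RHS]mulr_natl mulfV // pnatr_eq0 cardB -lt0n order_gt0.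
Qed.

Unset Implicit Arguments.
Local Open Scope ring_scope.

Theorem theorem3 (m n : nat) (m_gt0 : (0 < m)%N) (n_gt0 : (0 < n)%N)
    (co_mn : coprime m n) :
  (forall p q : nat, (p %| m)%N -> (q %| n)%N -> 0 < d p q) /\
  (D_T m n)%:R =
    \sum_(p <- divisors m) \sum_(q <- divisors n)
      1 / (p * q)%:R * (d p q)%:~R :> rat.
Proof.
have d_prim p q : (p %| m)%N -> (q %| n)%N ->
    d p q = #|primitive p q|%:R /\ (0 < #|primitive p q|)%N.
  move=> pm qn; have [p0 q0] := (dvdn_gt0 m_gt0 pm, dvdn_gt0 n_gt0 qn).
  have co_pq := coprime_dvdl pm (coprime_dvdr qn co_mn).
  by rewrite d_primitive // primitive_neq0.
split=> [p q pm qn|]; first by have [-> ] := d_prim p q pm qn; rewrite natz.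
rewrite D_T_inv_order // (sum_period_by_order (fun k => k%:R^-1) m_gt0) //.
apply: eq_big_seq => p; rewrite -dvdn_divisors // => pm.
apply: eq_big_seq => q; rewrite -dvdn_divisors // => qn.
by have [-> _] := d_prim p q pm qn; rewrite natz div1r mulr_natr.
Qed.
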